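(* Let $t\ge 1$ and $2\le \ell\le 4$ be integers. Then $\chi_p(P_{\ell t}\Diamond_\ell K_4)\le 4$ if $t=1$, $\chi_p(P_{\ell t}\Diamond_\ell K_4)\le 6$ if $t\in\{2,3\}$, and $\chi_p(P_{\ell t}\Diamond_\ell K_4)\le 8$ if $t\ge 4$. Moreover, equality holds for $t\in\{1,2,3\}$.
   Context: A packing $k$-coloring of a graph $H$ is a map $c:V(H)\to\{1,\ldots,k\}$ such that any two distinct vertices $u,v$ with $c(u)=c(v)=i$ satisfy $d_H(u,v)\ge i+1$. The packing chromatic number $\chi_p(H)$ is the least such $k$. $P_m$ denotes the path $v_1\cdots v_m$ and $K_n$ the complete graph on $n$ vertices. Path-aligned product: for positive integers $\ell\mid m$ and a connected vertex-transitive graph $G$ containing $P_\ell$ as a subgraph, $P_m\Diamond_\ell G$ is formed from the path $P_m=v_1\cdots v_m$ and $m/\ell$ pairwise disjoint copies of $G$, where for each $1\le i\le m/\ell$ the consecutive path vertices $v_{(i-1)\ell+1},\ldots,v_{i\ell}$ are identified, in order, with $\ell$ distinct vertices of the $i$-th copy of $G=K_n$. Consecutive copies are joined only by the path edges $v_{i\ell}v_{i\ell+1}$. *)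

(* Defs.v *)
From mathcomp Require Import all_boot.

Set Implicit Arguments.
Unset Strict Implicit.
Unset Printing Implicit Defensive.

(* A finite simple graph is a symmetric irreflexive e : rel T on a finType T.  *)

Section Distance.
Variables (T : finType) (e : rel T).

Definition walk (u v : T) (n : nat) : bool :=
  [exists p : n.-tuple T, path e u p && (last u p == v)].

Lemma connect_walk (u v : T) : connect e u v -> exists n, walk u v n.
Proof.
case/connectP=> p pP ->; exists (size p).
by apply/existsP; exists (in_tuple p); rewrite pP eqxx.
Qed.

(* None is the distance between vertices in different components. *)
Definition gdist (u v : T) : option nat :=
  match @idP (connect e u v) with
  | ReflectT uv => Some (ex_minn (connect_walk uv))
  | ReflectF _ => None
  end.

Definition dist_geq (u v : T) (n : nat) : bool :=
  if gdist u v is Some d then n <= d else true.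

(* The element i : 'I_k stands for the colour i.+1 of {1, .., k}. *)
Definition packing_coloring (k : nat) (c : {ffun T -> 'I_k}) : bool :=
  [forall u, forall v,
     (u != v) && (c u == c v) ==> dist_geq u v (c u).+1.+1].

Definition packing_colorable (k : nat) : bool :=
  [exists c : {ffun T -> 'I_k}, packing_coloring c].

Lemma ex_packing_colorable : exists k, packing_colorable k.
Proof.
exists #|T|; apply/existsP; exists [ffun x => enum_rank x].
apply/forallP=> u; apply/forallP=> v; apply/implyP=> /andP[/negP uv].
by rewrite !ffunE => /eqP/enum_rank_inj/eqP.
Qed.

Definition packing_chromatic_number : nat := ex_minn ex_packing_colorable.

End Distance.

Definition complete_graph (n : nat) : rel 'I_n := fun x y => x != y.

Section PathAligned.
Variables (t l : nat) (V : finType) (g : rel V) (f : 'I_t -> 'I_l -> V).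

(* With indices starting at 0, the i-th block of the path v_0 .. v_(l * t - 1)
   consists of the v_(i * l + j), j < l; f i j is the vertex of the i-th copy
   of G with which v_(i * l + j) is identified. *)
Definition is_path_vertex (k : nat) (x : 'I_t * V) : bool :=
  [exists j : 'I_l, (k == x.1 * l + j) && (x.2 == f x.1 j)].

Definition path_edge (x y : 'I_t * V) : bool :=
  [exists k : 'I_(l * t), is_path_vertex k x && is_path_vertex k.+1 y].

(* P_(l * t) <>_l G, on t disjoint copies of the graph (V, g). *)
Definition path_aligned : rel ('I_t * V)%type := fun x y =>
  [|| (x.1 == y.1) && g x.2 y.2, path_edge x y | path_edge y x].

Lemma path_aligned_sym : symmetric g -> symmetric path_aligned.
Proof.
move=> gS x y; rewrite /path_aligned eq_sym gS.
by rewrite [path_edge x y || _]orbC.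
Qed.

Lemma path_aligned_irr :
  (forall i, injective (f i)) -> irreflexive g -> irreflexive path_aligned.
Proof.
move=> fI gI x; rewrite /path_aligned gI andbF orbb /=.
apply/negbTE/negP=> /existsP[k /andP[/existsP[j /andP[/eqP kj /eqP xj]]]].
move=> /existsP[j' /andP[/eqP kj' /eqP xj']].
have jj' : j = j' by apply: (fI x.1); rewrite -xj.
by move: kj'; rewrite -jj' -kj => /eqP; rewrite gtn_eqF.
Qed.

End PathAligned.

(* Main.v *)
(** Let [a i] and [b i] be the first and the last path vertex of the [i]-th copy
    of [K_4]; the other two vertices of the copy are inner.

    Upper bounds: one periodic colouring serves every [t].  Colour 1 goes to
    every [a i], colour 2 to one inner vertex of every copy, the colours
    3, 5, 3, 7 go periodically to the [b i], and 4, 6, 4, 8 to the remaining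
    inner vertices.  Copies [i] and [j] are at distance [2 |i - j|] between
    their [b]'s and [2 |i - j| + 1] between inner vertices, which is enough.

    Lower bound for [t >= 2]: vertices of two consecutive copies are at distance
    at most 3, so these copies share at most the colours 1 and 2; they use
    4 colours each, hence at least 6 together. *)

Require Import Defs.
From mathcomp Require Import all_boot.
From mathcomp Require Import zify.

Section Walks.
Variables (T : finType) (e : rel T).
Implicit Types u v w : T.

Lemma walkP u v n :
  reflect (exists p : seq T, [/\ size p = n, path e u p & last u p = v])
          (walk e u v n).
Proof.
apply: (iffP existsP) => [[p /andP[pP /eqP pv]]|[p [<- pP pv]]].
  by exists p; rewrite size_tuple.
by exists (in_tuple p); rewrite pP pv eqxx.
Qed.

Lemma walk0 u : walk e u u 0.
Proof. by apply/walkP; exists [::]. Qed.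

Lemma walk1 u v : e u v -> walk e u v 1.
Proof. by move=> uv; apply/walkP; exists [:: v]; rewrite /= uv. Qed.

Lemma walk_add u v w m n : walk e u v m -> walk e v w n -> walk e u w (m + n).
Proof.
move=> /walkP[p [<- pP <-]] /walkP[q [<- qP <-]]; apply/walkP.
by exists (p ++ q); rewrite size_cat cat_path last_cat pP.
Qed.

Lemma dist_geqP u v n :
  reflect (forall m, walk e u v m -> n <= m) (dist_geq e u v n).
Proof.
rewrite /dist_geq /gdist; case: {-}_ / idP => [uv|nuv].
  case: ex_minnP => d wd dmin; apply: (iffP idP) => [nd m /dmin|]; last exact.
  exact: leq_trans.
constructor=> m /walkP[p [_ pP pv]]; case: nuv; apply/connectP; by exists p.
Qed.

Lemma lipschitz_dist_geq (phi : T -> nat) u v n :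
    (forall x y, e x y -> phi x <= (phi y).+1 /\ phi y <= (phi x).+1) ->
  phi u + n <= phi v \/ phi v + n <= phi u -> dist_geq e u v n.
Proof.
move=> phiL uv; apply/dist_geqP => m /walkP[p [<- pP pv]].
suff: phi u <= phi v + size p /\ phi v <= phi u + size p by lia.
rewrite -pv {n uv pv}; elim: p u pP => [|x p IHp] u /=; first by lia.
by case/andP=> /phiL ? /IHp; lia.
Qed.

Lemma packing_chromatic_number_leq k (c : T -> nat) :
    (forall u, c u < k) ->
    (forall u v, u != v -> c u = c v -> dist_geq e u v (c u).+2) ->
  packing_chromatic_number e <= k.
Proof.
move=> ck cP; rewrite /packing_chromatic_number; case: ex_minnP => m _; apply.
apply/existsP; exists [ffun u => Ordinal (ck u)].
apply/forallP=> u; apply/forallP=> v; apply/implyP=> /andP[uv].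
rewrite !ffunE => /eqP/(congr1 val) /=; exact: cP.
Qed.

Lemma packing_chromatic_number_geq k :
    (forall m (c : T -> 'I_m),
      (forall u v n, u != v -> c u = c v -> walk e u v n -> (c u).+1 < n) ->
      k <= m) ->
  k <= packing_chromatic_number e.
Proof.
move=> kP; rewrite /packing_chromatic_number; case: ex_minnP => m /existsP[c cP].
move=> _; apply: (kP m c) => u v n uv cuv.
by apply/dist_geqP; have /forallP/(_ v) := forallP cP u; rewrite uv cuv eqxx.
Qed.

End Walks.

Section CompleteCopies.
Variables (t l : nat) (f : 'I_t -> 'I_l.+2 -> 'I_4).
Hypothesis f_inj : forall i, injective (f i).

Local Notation E := (path_aligned (@complete_graph 4) f).
Local Notation V := ('I_t * 'I_4)%type.

Definition entry (i : 'I_t) : 'I_4 := f i ord0.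
Definition exit (i : 'I_t) : 'I_4 := f i ord_max.

Lemma exit_neq_entry i : exit i != entry i.
Proof. by rewrite (inj_eq (f_inj i)). Qed.

Lemma path_edge_cases (x y : V) : path_edge f x y ->
  x.1 = y.1 \/ [/\ y.1 = x.1.+1 :> nat, x.2 = exit x.1 & y.2 = entry y.1].
Proof.
case: x y => [x p] [y q] /existsP[k] /=.
case/andP=> /existsP[j /andP[/eqP /= kj /eqP /= pj]].
case/existsP=> j' /andP[/eqP /= kj' /eqP /= qj].
have jl := ltn_ord j; have jl' := ltn_ord j'.
have [xy|yx|xy] := ltngtP x y; last by left; apply: val_inj.
- have xyl : x.+1 * l.+2 <= y * l.+2 by rewrite leq_mul2r.
  have y1 : y = x.+1 :> nat.
    have : y * l.+2 < x.+2 * l.+2 by lia.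
    by rewrite ltn_pmul2r //; lia.
  right; split=> //; rewrite /exit /entry ?pj ?qj; congr (f _ _); apply: val_inj => /=.
    by move: kj'; rewrite y1; lia.
  by move: kj'; rewrite y1; lia.
- have : y.+1 * l.+2 <= x * l.+2 by rewrite leq_mul2r.
  by lia.
Qed.

Lemma path_aligned_exit_entry (i j : 'I_t) :
  j = i.+1 :> nat -> E (i, exit i) (j, entry j).
Proof.
move=> ji; have kl : i * l.+2 + l.+1 < l.+2 * t.
  have : i.+1 * l.+2 <= t * l.+2 by rewrite leq_mul2r ltn_ord orbT.
  by lia.
apply/or3P/Or32/existsP; exists (Ordinal kl); apply/andP; split; apply/existsP.
  by exists ord_max; rewrite /= !eqxx.
by exists ord0; rewrite /= ji eqxx andbT; lia.
Qed.

Lemma walk_copy i (p q : 'I_4) : walk E (i, p) (i, q) (p != q).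
Proof.
have [->|pq] := eqVneq p q; first exact: walk0.
by apply: walk1; apply/or3P/Or31; rewrite /= eqxx.
Qed.

Lemma walk_consecutive (i j : 'I_t) (p q : 'I_4) : j = i.+1 :> nat ->
  exists2 n, n <= 3 & walk E (i, p) (j, q) n.
Proof.
move=> ji; exists ((p != exit i) + (1 + (entry j != q))); first by lia.
apply: walk_add (walk_copy i p (exit i)) _.
by apply: walk_add (walk_copy j (entry j) q); apply/walk1/path_aligned_exit_entry.
Qed.

Section LowerBound.
Variables (m : nat) (c : V -> 'I_m).
Hypothesis cP :
  forall u v n, u != v -> c u = c v -> walk E u v n -> (c u).+1 < n.

Lemma copy_colors_inj i : injective (fun p => c (i, p)).
Proof.
move=> p q cpq; apply/eqP; apply/negPn/negP=> pq.
have := cP (i, p) (i, q) _ _ cpq (walk_copy i p q).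
by rewrite xpair_eqE eqxx pq => /(_ isT).
Qed.

Let colors i : {set 'I_m} := [set c (i, p) | p in 'I_4].

Lemma card_copy_colors i : #|colors i| = 4.
Proof. by rewrite card_imset ?card_ord //; apply: copy_colors_inj. Qed.

Lemma leq4_packing : 0 < t -> 4 <= m.
Proof.
move=> t0; rewrite -(card_copy_colors (Ordinal t0)).
by rewrite (leq_trans (max_card _)) ?card_ord.
Qed.

Lemma shared_colors_lt2 (i j : 'I_t) (k : 'I_m) : j = i.+1 :> nat ->
  k \in colors i :&: colors j -> k < 2.
Proof.
move=> ji /setIP[/imsetP[p _ kp] /imsetP[q _ kq]].
have [n n3 w] := walk_consecutive i j p q ji.
have ij : (i, p) != (j, q).
  by apply/eqP=> -[/(congr1 val) /= ij _]; move: ji; rewrite -ij; lia.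
have := cP _ _ _ ij (etrans (esym kp) kq) w; rewrite -kp; lia.
Qed.

Lemma leq6_packing : 1 < t -> 6 <= m.
Proof.
move=> t1; pose i := Ordinal (ltnW t1); pose j := Ordinal t1.
have card2 : #|colors i :&: colors j| <= 2.
  rewrite cardE -(size_map val) -[leqRHS](size_iota 0 2).
  apply: uniq_leq_size; first by rewrite map_inj_uniq ?enum_uniq //; apply: val_inj.
  move=> _ /mapP[k + ->]; rewrite mem_enum mem_iota /= => /shared_colors_lt2; exact.
have cardU : #|colors i :|: colors j| <= m by rewrite -[leqRHS]card_ord max_card.
by have := cardsUI (colors i) (colors j); rewrite !card_copy_colors; lia.
Qed.

End LowerBound.

Definition inner_vertex (i : 'I_t) : 'I_4 :=
  odflt ord0 [pick p | (p != entry i) && (p != exit i)].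

Lemma inner_vertexP i :
  (inner_vertex i != entry i) && (inner_vertex i != exit i).
Proof.
rewrite /inner_vertex; case: pickP => //= none.
have := cardsC [set entry i; exit i]; rewrite cards2 card_ord.
rewrite [#|~: _|](_ : _ = 0); first by case: eqP.
by apply/eqP; rewrite cards_eq0; apply/eqP/setP=> p; rewrite !inE negb_or none.
Qed.

Lemma remaining_unique i (p q : 'I_4) :
  p \notin [set entry i; exit i; inner_vertex i] ->
  q \notin [set entry i; exit i; inner_vertex i] -> p = q.
Proof.
set A := [set _; _; _] => pA qA.
have cA : #|A| = 3.
  have /andP[na nb] := inner_vertexP i.
  rewrite /A setUC cardsU1 !inE (negbTE na) (negbTE nb) cards2.
  by rewrite eq_sym exit_neq_entry.
have := cardsC A; rewrite card_ord cA => /eqP; rewrite (eqn_add2l 3 _ 1).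
case/cards1P=> r Ar; have : (p \in ~: A) && (q \in ~: A) by rewrite !in_setC pA qA.
by rewrite Ar !inE => /andP[/eqP-> /eqP->].
Qed.

(* Colours are shifted by one, as in [packing_coloring]: the [exit]s get
   3, 5, 3, 7 in the paper's numbering. *)
Definition exit_color (i : nat) : nat :=
  if odd i then (if i %% 4 == 1 then 4 else 6) else 2.

Definition color (x : V) : nat :=
  if x.2 == entry x.1 then 0
  else if x.2 == exit x.1 then exit_color x.1
  else if x.2 == inner_vertex x.1 then 1
  else (exit_color x.1).+1.

Lemma exit_color_gap (i j : nat) : i < j ->
  exit_color i = exit_color j -> i.*2 + (exit_color i).+2 <= j.*2.
Proof. by rewrite /exit_color; do 4?case: ifP; lia. Qed.

Lemma exit_color_neq_succ (i j : nat) : exit_color i <> (exit_color j).+1.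
Proof. by rewrite /exit_color; do 4?case: ifP. Qed.

Lemma exit_color_gt1 (i : nat) : 1 < exit_color i.
Proof. by rewrite /exit_color; do 2?case: ifP. Qed.

Lemma color_leq (x : V) : color x <= (exit_color x.1).+1.
Proof. by rewrite /color; do 3?case: ifP. Qed.

(* A position along the path.  Inner vertices of copies up to [i] are put on the
   entry, the later ones on the exit, so that inner vertices of copy [i] and
   of a later copy are at their true distance. *)
Definition position (i : 'I_t) (x : V) : nat :=
  (x.1).*2 + ((x.2 == exit x.1) || (x.2 != entry x.1) && (i < x.1)).

Lemma position_lipschitz i (x y : V) : E x y ->
  position i x <= (position i y).+1 /\ position i y <= (position i x).+1.
Proof.
case: x y => [x p] [y q]; rewrite /position /=.
case/or3P=> [|/path_edge_cases|/path_edge_cases] /=.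
- by case/andP=> /eqP /= -> _; lia.
- case=> [->|[-> -> ->]]; first by lia.
  by rewrite !eqxx /= [entry _ == _]eq_sym (negbTE (exit_neq_entry _)); lia.
- case=> [->|[-> -> ->]]; first by lia.
  by rewrite !eqxx /= [entry _ == _]eq_sym (negbTE (exit_neq_entry _)); lia.
Qed.

Lemma color_gap (x y : V) : x.1 < y.1 -> color x = color y ->
  position x.1 x + (color x).+2 <= position x.1 y.
Proof.
case: x y => [i p] [j q] /= ij; have := exit_color_gap _ _ ij.
have := exit_color_neq_succ i j; have := exit_color_neq_succ j i.
have := exit_color_gt1 i; have := exit_color_gt1 j.
rewrite /position /color /= ij ltnn.
have nie := exit_neq_entry i; have nje := exit_neq_entry j.
have [->|] := eqVneq p (entry i); have [->|] := eqVneq q (entry j);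
  rewrite ?[entry _ == exit _]eq_sym ?(negbTE nie) ?(negbTE nje);
  do 4?case: ifP; lia.
Qed.

Lemma color_copy_inj (i : 'I_t) (p q : 'I_4) :
  color (i, p) = color (i, q) -> p = q.
Proof.
have := exit_color_gt1 i; rewrite /color /=.
have [pa|pa] := eqVneq p (entry i); have [qa|qa] := eqVneq q (entry i);
have [pb|pb] := eqVneq p (exit i); have [qb|qb] := eqVneq q (exit i);
have [pc|pc] := eqVneq p (inner_vertex i);
have [qc|qc] := eqVneq q (inner_vertex i); try by [lia | congruence].
by move=> _ _; apply: (remaining_unique i); rewrite !inE !negb_or ?pa ?pb ?qa ?qb.
Qed.

Lemma color_dist_geq (x y : V) : x != y -> color x = color y ->
  dist_geq E x y (color x).+2.
Proof.
move=> xy cxy; have [lt|gt|eq] := ltngtP x.1 y.1.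
- apply: (lipschitz_dist_geq _ _ _ _ _ _ (position_lipschitz x.1)).
  by left; apply: color_gap.
- apply: (lipschitz_dist_geq _ _ _ _ _ _ (position_lipschitz y.1)).
  by right; rewrite cxy; apply: color_gap.
- case/eqP: xy; case: x y cxy eq => [i p] [j q] /= + /val_inj ij.
  by rewrite -{}ij => /color_copy_inj->.
Qed.

End CompleteCopies.

Theorem theorem15 (t l : nat) (f : 'I_t -> 'I_l -> 'I_4)
    (ht : 1 <= t) (hl : 2 <= l <= 4) (hf : forall i : 'I_t, injective (f i)) :
  let chi := packing_chromatic_number (path_aligned (@complete_graph 4) f) in
  [/\ t = 1 -> chi <= 4,
      t = 2 \/ t = 3 -> chi <= 6,
      4 <= t -> chi <= 8,
      t = 1 -> chi = 4 &
      t = 2 \/ t = 3 -> chi = 6].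
Proof.
move=> chi.
case: l f hl hf @chi => [|[|l]] f // _ hf chi.
have upper k : (forall i : 'I_t, (exit_color i).+1 < k) -> chi <= k.
  move=> ck; apply: (packing_chromatic_number_leq _ _ _ (color _ _ f)).
    by move=> x; apply: leq_ltn_trans (ck x.1); apply: color_leq.
  by move=> x y; apply: color_dist_geq.
have upper4 : t = 1 -> chi <= 4.
  move=> t1; apply: upper => i; have : i < 1 by have := ltn_ord i; lia.
  by case: (nat_of_ord i).
have upper6 : t = 2 \/ t = 3 -> chi <= 6.
  move=> t23; apply: upper => i; have : i < 3 by have := ltn_ord i; lia.
  by case: (nat_of_ord i) => [|[|[|]]].
split=> //.
- by move=> _; apply: upper => i; rewrite /exit_color; do 2?case: ifP.
- move=> t1; apply/eqP; rewrite eqn_leq upper4 //=.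
  by apply: packing_chromatic_number_geq => m c /leq4_packing; apply.
- move=> t23; apply/eqP; rewrite eqn_leq upper6 //=.
  apply: packing_chromatic_number_geq => m c /leq6_packing; apply; lia.
Qed.
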